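(* The infinite component problem for unary automatic graphs of finite degree is solvable in time $O(p^3)$: there is an algorithm which, given a (standard one-loop) automaton with loop constant $p$ recognizing the edge relation of a unary automatic graph of finite degree $\mathcal{G}$, decides in time $O(p^{3})$ whether $\mathcal{G}$ has an infinite component.
   Context: Let $\diamond$ be a symbol different from $1$. The convolution $\otimes(1^m,1^n)$ is the word of length $\max(m,n)$ over $\{1,\diamond\}^2$ whose $k$-th letter is $(a,b)$, where $a=1$ if $k\le m$ and $a=\diamond$ otherwise, and $b=1$ if $k\le n$ and $b=\diamond$ otherwise. An automaton (always a deterministic finite automaton) recognizes a binary relation $E\subseteq 1^\star\times 1^\star$ if it accepts exactly the convolutions of the pairs in $E$. A unary automatic graph is a graph $\mathcal{G}=(V,E)$ with $V=1^\star$ and $E$ recognized by some automaton. Graphs are undirected ($E$ is symmetric). A graph is of finite degree if there are only finitely many edges from each vertex. A component is a connected component. In an automaton recognizing a binary relation over $1^\star$, the $(1,1)$-states are the states reachable from the initial state by reading letters $(1,1)$; they form a disjoint union of a tail (a sequence of states linked by transitions without repetition) and a loop (a cycle), called the $(1,1)$-tail and $(1,1)$-loop. For a $(1,1)$-state $s$, the states reachable from $s$ by reading letters $(1,\diamond)$ (resp. $(\diamond,1)$) likewise form $(1,\diamond)$-tails and loops (resp. $(\diamond,1)$-tails and loops). A one-loop automaton is one whose transition diagram contains exactly one loop, the $(1,1)$-loop. It is standard with loop constant $p$ if its loop and all its tails have length $p$; thus it has $p$ states on the $(1,1)$-tail, $p$ states on the $(1,1)$-loop, and from each of these $2p$ states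 a $(1,\diamond)$-tail and a $(\diamond,1)$-tail of length $p$. A unary automatic graph of finite degree is always given by a standard one-loop automaton recognizing its edge relation. The infinite component problem: given such an automaton for $\mathcal{G}$, decide whether $\mathcal{G}$ has an infinite component. *)

(* Defs.v *)
From mathcomp Require Import all_boot.
From mathcomp Require Import boolp classical_sets cardinality.
From Stdlib Require Import Relation_Operators.

Set Implicit Arguments.
Unset Strict Implicit.
Unset Printing Implicit Defensive.

(* The vertex 1^n is represented by its length n.  In a letter, [true] stands
   for the symbol 1 and [false] for the padding symbol. *)
Definition letter : Type := (bool * bool)%type.
Definition l11 : letter := (true, true).
Definition l1d : letter := (true, false).
Definition ld1 : letter := (false, true).
Definition ldd : letter := (false, false).

(* Positions are counted from 0 here, so the component at k is 1 iff k < m. *)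
Definition conv (m n : nat) : seq letter :=
  mkseq (fun k => (k < m, k < n)) (maxn m n).

(* Transitions are partial: a missing transition rejects.  In particular a tail
   ends at a state without successor, not at a looping sink. *)
Record dfa (N : nat) := Dfa {
  init : 'I_N;
  delta : 'I_N -> letter -> option 'I_N;
  final : pred 'I_N }.

Definition runs N (A : dfa N) (q : 'I_N) (w : seq letter) : option 'I_N :=
  foldl (fun o a => obind (fun r => delta A r a) o) (Some q) w.

Definition accepts N (A : dfa N) (w : seq letter) : bool :=
  if runs A (init A) w is Some q then final A q else false.

Definition recognizes N (A : dfa N) (E : nat -> nat -> Prop) : Prop :=
  forall w, accepts A w <-> exists m n, w = conv m n /\ E m n.

Definition state11 N (A : dfa N) (k : nat) : option 'I_N :=
  runs A (init A) (nseq k l11).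

(* The (1,1)-states are t tail states followed by l loop states. *)
Definition lasso11 N (A : dfa N) (t l : nat) : Prop :=
  [/\ 0 < l,
      forall i, i < t + l -> state11 A i <> None,
      forall i j, i < t + l -> j < t + l -> state11 A i = state11 A j -> i = j
    & state11 A (t + l) = state11 A t].

(* Every closed walk in the transition diagram goes around the (1,1)-loop. *)
Definition one_loop N (A : dfa N) (t l : nat) : Prop :=
  lasso11 A t l /\
  forall q w, w <> [::] -> runs A q w = Some q ->
    (exists2 i, t <= i < t + l & state11 A i = Some q) /\
    all (pred1 l11) w.

(* The states of the tail are those reached from s by a nonempty power of a;
   they are distinct, since a repetition would make every power readable. *)
Definition tail_of_length N (A : dfa N) (s : 'I_N) (a : letter) (k : nat) :
    Prop :=
  runs A s (nseq k a) <> None /\ runs A s (nseq k.+1 a) = None.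

Definition standard_one_loop N (A : dfa N) (p : nat) : Prop :=
  one_loop A p p /\
  forall i s, state11 A i = Some s ->
    tail_of_length A s l1d p /\ tail_of_length A s ld1 p.

Definition undirected (E : nat -> nat -> Prop) : Prop :=
  forall m n, E m n -> E n m.

Definition finite_degree (E : nat -> nat -> Prop) : Prop :=
  forall m, finite_set [set n | E m n]%classic.

Definition component (E : nat -> nat -> Prop) (v : nat) : set nat :=
  [set u | clos_refl_trans nat E v u]%classic.

Definition has_infinite_component (E : nat -> nat -> Prop) : Prop :=
  exists v, infinite_set (component E v).

(* Random access machines in the style of Cook and Reckhow, under the uniform
   cost criterion: cells X_0, X_1, ... contain natural numbers and are
   initially 0, the input is a read-only array, every instruction takes one
   unit of time. *)
Inductive instr : Type :=
| IConst of nat & nat         (* X_i <- c *)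
| IAdd of nat & nat & nat     (* X_i <- X_j + X_k *)
| ISub of nat & nat & nat     (* X_i <- X_j - X_k, truncated at 0 *)
| ILoad of nat & nat          (* X_i <- X_(X_j) *)
| IStore of nat & nat         (* X_(X_i) <- X_j *)
| IRead of nat & nat          (* X_i <- input[X_j], 0 when out of range *)
| IJump of nat & nat.         (* go to instruction l if X_j > 0 *)

Record config := Config { pc : nat; mem : nat -> nat }.

Definition upd (X : nat -> nat) (i v : nat) : nat -> nat :=
  fun j => if j == i then v else X j.

Definition exec (x : seq nat) (ins : instr) (c : config) : config :=
  let X := mem c in
  let next X' := Config (pc c).+1 X' in
  match ins with
  | IConst i v => next (upd X i v)
  | IAdd i j k => next (upd X i (X j + X k))
  | ISub i j k => next (upd X i (X j - X k))
  | ILoad i j => next (upd X i (X (X j)))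
  | IStore i j => next (upd X (X i) (X j))
  | IRead i j => next (upd X i (nth 0 x (X j)))
  | IJump j l => if 0 < X j then Config l X else next X
  end.

(* The machine halts when the program counter leaves the program. *)
Definition halted (P : seq instr) (c : config) : bool := size P <= pc c.

Definition step (P : seq instr) (x : seq nat) (c : config) : config :=
  if onth P (pc c) is Some ins then exec x ins c else c.

Definition ram_run (P : seq instr) (x : seq nat) (T : nat) : config :=
  iter T (step P x) (Config 0 (fun=> 0)).

Definition answers_within (P : seq instr) (x : seq nat) (T : nat) (b : bool) :
    Prop :=
  halted P (ram_run P x T) /\ mem (ram_run P x T) 0 = b.

Definition encode_target N (o : option 'I_N) : nat :=
  if o is Some q then (q : nat).+1 else 0.

Definition encode_state N (A : dfa N) (q : 'I_N) : seq nat :=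
  [:: nat_of_bool (final A q);
      encode_target (delta A q l11); encode_target (delta A q l1d);
      encode_target (delta A q ld1); encode_target (delta A q ldd)].

(* The transition table; the row of state q starts at index 5 * q + 2. *)
Definition encode N (A : dfa N) : seq nat :=
  [:: N, nat_of_ord (init A) & flatten [seq encode_state A q | q <- enum 'I_N]].

(* Main.v *)
Require Import Defs.
From mathcomp Require Import all_boot.
From mathcomp Require Import boolp classical_sets cardinality zify.
From Stdlib Require Import Relation_Operators.

Set Implicit Arguments.
Unset Strict Implicit.
Unset Printing Implicit Defensive.

(* Every edge joins some n and n + j with j <= p, and for n >= p its presence
   depends only on j and n mod p.  So, up to finitely many vertices of finite
   degree, the graph is the nonnegative half of a Z-cover of a graph on the
   residues mod p, the edge from u to (u + j) mod p being labelled by the number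
   (u + j) / p of blocks it crosses.  An infinite component exists iff the
   residues carry a closed walk of nonzero total label, i.e. iff there is no
   potential h with h(target) = h(source) + label on all edges.  The machine
   builds such a potential by weighted union of classes: an edge between two
   classes shifts one of them and merges them in O(p) steps, an edge inside a
   class is checked.  There are O(p^2) edges. *)

(** * Potentials on the residues *)

Section Potentials.

Variables (E : nat -> nat -> Prop) (p : nat) (t : nat -> nat -> bool).
Hypothesis p_gt0 : 0 < p.
Hypothesis E_sym : undirected E.
Hypothesis E_short : forall n j, E n (n + j) -> j <= p.
Hypothesis E_periodic : forall n j, p <= n -> j <= p -> E n (n + j) <-> t (n %% p) j.

(* The pair [(u, j)] stands for the edges between [k * p + u] and
   [k * p + u + j] for [0 < k]; the latter lies in block [k + shift]. *)
Definition target (e : nat * nat) := (e.1 + e.2) %% p.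
Definition shift (e : nat * nat) := (e.1 + e.2) %/ p.
Definition edge (e : nat * nat) := [&& e.1 < p, e.2 <= p & t e.1 e.2].

Lemma connected_sym m n : clos_refl_trans nat E m n -> clos_refl_trans nat E n m.
Proof.
elim=> [x y /E_sym xy|x|x y z _ yx _ zy]; [exact: rt_step|exact: rt_refl|].
exact: rt_trans zy yx.
Qed.

(* In the quotient modulo [p], [a] at height [x] and [b] at height [y] are
   connected by a walk; it lifts to the graph when started far enough from 0. *)
Definition joined a x b y := exists K, forall k, K <= k ->
  clos_refl_trans nat E ((k + x) * p + a) ((k + y) * p + b).

Lemma joined_refl a x : joined a x a x.
Proof. by exists 0 => k _; exact: rt_refl. Qed.

Lemma joined_sym a x b y : joined a x b y -> joined b y a x.
Proof. by case=> K HK; exists K => k /HK; exact: connected_sym. Qed.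

Lemma joined_trans a x b y c z :
  joined a x b y -> joined b y c z -> joined a x c z.
Proof.
case=> K HK [L HL]; exists (maxn K L) => k; rewrite geq_max => /andP[/HK ab /HL].
exact: rt_trans.
Qed.

(** A common shift of the heights only changes the threshold [K]. *)
Lemma joined_addr d a x b y : joined a (x + d) b (y + d) <-> joined a x b y.
Proof.
split=> -[K HK]; last first.
  by exists K => k Kk; rewrite ![_ + d]addnC !addnA; apply: HK; lia.
exists (K + d) => k Kk; have := HK (k - d).
by rewrite ![_ + d]addnC !addnA subnK; [apply; lia|lia].
Qed.

Lemma edge_joined e x : edge e -> joined e.1 x (target e) (x + shift e).
Proof.
(* From block 1 on the source is at least [p], where the edges are periodic. *)
case/and3P=> ap jp tj; exists 1 => k k1; apply: rt_step.
have -> : (k + (x + shift e)) * p + target e = ((k + x) * p + e.1) + e.2.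
  by rewrite addnA mulnDl -!addnA -divn_eq.
have kx : p <= (k + x) * p by rewrite leq_pmull// addn_gt0 k1.
by apply/E_periodic; rewrite ?modnMDl ?modn_small// (leq_trans kx) ?leq_addr.
Qed.

Lemma infinite_set_unbounded (S : set nat) :
  (forall B, exists2 n, S n & B <= n) -> infinite_set S.
Proof.
move=> S_ub /finite_seqP[s Ss].
have [n Sn Sn2] := S_ub (\sum_(i <- s) i).+1.
suff : n <= \sum_(i <- s) i by rewrite leqNgt Sn2.
have ns : n \in s by move: Sn; rewrite Ss.
by rewrite (big_rem n ns) /= leq_addr.
Qed.

(** A closed walk of nonzero total shift can be repeated: every lap climbs [y - x] blocks, so one
    component contains arbitrarily large vertices. *)
Lemma joined_infinite a x y :
  joined a x a y -> x != y -> has_infinite_component E.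
Proof.
wlog xy : x y / x < y => [H axay|].
  case: ltngtP (H x y) (H y x) => // xy H1 H2 _; first exact: H1.
  by apply: H2 (joined_sym axay) _ => //; lia.
case=> K HK _; exists ((K + x) * p + a); apply: infinite_set_unbounded => B.
exists ((K + x + B * (y - x)) * p + a); last first.
  have Bd : B <= B * (y - x) by rewrite leq_pmulr// subn_gt0.
  by rewrite (leq_trans _ (leq_addr _ _))// (leq_trans _ (leq_pmulr _ p_gt0))//; lia.
rewrite /component /=; elim: B => [|B]; first by rewrite addn0; exact: rt_refl.
move=> IH; apply: rt_trans IH _; have := HK (K + B * (y - x)) (leq_addr _ _).
by rewrite addnAC; congr (clos_refl_trans _ _ _ (_ * p + a)); lia.
Qed.

(** Makes a failed check conclusive: potentials within a class are realised by walks, so a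
    discrepancy yields a closed walk of nonzero shift. *)
Definition sound (c h : nat -> nat) := forall a b, a < p -> b < p ->
  c a = c b -> joined a (h a) b (h b).

Definition consistent (c h : nat -> nat) (e : nat * nat) :=
  c e.1 = c (target e) /\ h (target e) = h e.1 + shift e.

(* Truncated differences; at most one is nonzero, so at most one of the two
   classes is moved, and potentials stay natural numbers. *)
Definition gap_up (h : nat -> nat) e := h e.1 + shift e - h (target e).
Definition gap_down (h : nat -> nat) e := h (target e) - (h e.1 + shift e).

(** If the classes differ, raising that of the source by [gap_down] and that of the target by
    [gap_up] makes [e] consistent. If they coincide, either both gaps are 0 or [merge_flag] is
    positive. *)
Definition merge_h (c h : nat -> nat) e w := h w + (c w == c e.1) * gap_down h e
  + (c w == c (target e)) * gap_up h e.
Definition merge_c (c : nat -> nat) e w :=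
  if c w == c (target e) then c e.1 else c w.
Definition merge_flag f (c h : nat -> nat) e : nat :=
  f + (c e.1 == c (target e)) * (gap_up h e + gap_down h e).

(** A positive flag is final: it certifies an infinite component, and then nothing is claimed about
    [c] and [h]. *)
Definition potential_inv (L : nat * nat -> Prop) f c h :=
  if f is 0 then sound c h /\ forall e, edge e -> L e -> consistent c h e
  else has_infinite_component E.

Lemma potential_inv0 c h : injective c -> potential_inv (fun=> False) 0 c h.
Proof. by move=> c_inj; split=> // a b _ _ /c_inj ->; exact: joined_refl. Qed.

Lemma target_lt e : target e < p. Proof. exact: ltn_pmod. Qed.

Lemma potential_inv_ext (L L' : nat * nat -> Prop) f c h c' h' :
  (forall w, w < p -> c' w = c w) -> (forall w, w < p -> h' w = h w) ->
  (forall e, edge e -> L' e -> L e) ->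
  potential_inv L f c h -> potential_inv L' f c' h'.
Proof.
move=> cc hh LL; case: f => //= -[snd cst]; split.
  by move=> a b ap bp; rewrite !cc// !hh//; exact: snd.
move=> e edge_e Le; have := cst e edge_e (LL e edge_e Le).
have [ap _ _] := and3P edge_e.
by rewrite /consistent !cc ?hh ?target_lt.
Qed.

Lemma merge_inv L f c h e : edge e -> potential_inv L f c h ->
  potential_inv (fun e' => e' = e \/ L e') (merge_flag f c h e)
    (merge_c c e) (merge_h c h e).
Proof.
case: f => [|f] edge_e //= [snd cst].
have [ap _ _] := and3P edge_e; have bp := target_lt e.
have ab := edge_joined (h e.1) edge_e.
have [cab|cab] := eqVneq (c e.1) (c (target e)).
  have /joined_sym ba := snd _ _ ap bp cab.
  rewrite /merge_flag cab eqxx mul1n add0n.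
  have [gap0|gap] := posnP (gap_up h e + gap_down h e); last first.
    (* Going back inside the class and then along [e] returns to the target at another height. *)
    suff inf : has_infinite_component E by case: (_ + _) gap.
    apply: joined_infinite (joined_trans ba ab) _.
    by move: gap; rewrite /gap_up /gap_down; case: eqP => //; lia.
  have [up0 down0] : gap_up h e = 0 /\ gap_down h e = 0 by lia.
  rewrite gap0.
  have cc w : merge_c c e w = c w by rewrite /merge_c; case: eqP => // ->.
  have hh w : merge_h c h e w = h w by rewrite /merge_h up0 down0; lia.
  apply: (@potential_inv_ext (fun e' => e' = e \/ L e') _ 0 c h) => //.
  split=> // e' edge_e' [->|]; last exact: cst.
  by split=> //; move: up0 down0; rewrite /gap_up /gap_down; lia.
rewrite /merge_flag (negPf cab) mul0n addn0 /=.
have gapE : h (target e) + gap_up h e = h e.1 + shift e + gap_down h e.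
  by rewrite /gap_up /gap_down; lia.
(* At their raised heights, members of the two classes are joined through [e] taken backwards. *)
have cross a b : a < p -> b < p -> c a = c (target e) -> c b = c e.1 ->
    joined a (h a + gap_up h e) b (h b + gap_down h e).
  move=> a_p b_p ca cb.
  apply: joined_trans (iffRL (joined_addr _ _ _ _ _) (snd _ _ a_p bp ca)) _.
  rewrite gapE; apply/joined_addr; apply: joined_trans (joined_sym ab) _.
  exact: snd.
split=> [a b a_p b_p|e' edge_e'].
  rewrite /merge_c /merge_h.
  have [ca|ca] := eqVneq (c a) (c (target e)); have [cb|cb] := eqVneq (c b) (c (target e)).
  - rewrite ca cb eq_sym (negPf cab) !mul0n !mul1n !addn0 => _.
    by apply/joined_addr/snd => //; rewrite ca.
  - move=> ce; rewrite ca -ce eqxx eq_sym (negPf cab) !mul0n !mul1n !addn0.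
    exact: cross.
  - move=> ce; rewrite cb ce eqxx eq_sym (negPf cab) !mul0n !mul1n !addn0.
    by apply/joined_sym/cross.
  - move=> ce; rewrite ce !mul0n !addn0; apply/joined_addr; exact: snd.
have [ap' _ _] := and3P edge_e'.
case=> [->|/(cst _ edge_e')[ce' he']]; rewrite /consistent /merge_c /merge_h.
  rewrite !eqxx (negPf cab) eq_sym (negPf cab); split=> //; lia.
(* An earlier edge has both endpoints in one class, so both potentials move by the same amount. *)
rewrite -ce' he'; split=> //; lia.
Qed.

(** * Consistent potentials force finite components *)

Lemma E_near m n : E m n -> n <= m + p.
Proof.
have [mn|/ltnW nm] := leqP m n; last by move=> _; lia.
by rewrite -{1}(subnKC mn) => /E_short; lia.
Qed.

(** The difference [m %/ p - h (m %% p)] is constant along edges beyond [p]; it may be negative,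
    hence the additive form. *)
Lemma consistent_step c h m n :
  (forall e, edge e -> consistent c h e) -> p <= m -> p <= n -> E m n ->
  m %/ p + h (n %% p) = n %/ p + h (m %% p).
Proof.
move=> cst.
wlog mn : m n / m <= n => [H pm pn mn|pm _ Emn].
  case: (leqP m n) => [|/ltnW] nm; first exact: H.
  by apply/esym/H => //; exact: E_sym.
have jp := E_near Emn.
have edge_e : edge (m %% p, n - m).
  have nmp : n - m <= p by lia.
  by rewrite /edge /= ltn_pmod// nmp /=; apply/E_periodic; rewrite ?subnKC.
have [_ hE] := cst _ edge_e.
have nE : n = m %/ p * p + (m %% p + (n - m)) by rewrite addnA -divn_eq subnKC.
rewrite {1 2}nE modnMDl divnMDl// -[(_ + _) %% p]/(target (m %% p, n - m)) hE /shift /=; lia.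
Qed.

Lemma consistent_finite c h :
  (forall e, edge e -> consistent c h e) -> ~ has_infinite_component E.
Proof.
move=> cst [v]; apply.
(* [B] exceeds the start [v] and every neighbour of a vertex below [p]; [M] bounds the
   potentials. *)
pose B := maxn (2 * p) v.+1; pose M := \sum_(w < p) h w.
have hM w : w < p -> h w <= M.
  by move=> wp; rewrite /M (bigD1 (Ordinal wp)) //= leq_addr.
(* A walk leaves the aperiodic part [0, p) only to vertices below [2 * p]. *)
pose Q n := n < p \/ exists2 w, w < B & w %/ p + h (n %% p) = n %/ p + h (w %% p).
have QE m n : E m n -> Q m -> Q n.
  move=> Emn Qm; have [np|pn] := ltnP n p; [by left|right].
  have [mp|pm] := ltnP m p.
    by exists n => //; have := E_near Emn; lia.
  case: Qm => [|[w wB wE]]; first by lia.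
  by exists w => //; have := consistent_step cst pm pn Emn; lia.
have Qv : Q v by right; exists v => //; lia.
(* The block number of [n] is at most [w %/ p + h (n %% p)], hence below [B + M]. *)
apply: (@sub_finite_set _ _ `I_((B + M).+1 * p)); last exact: finite_II.
move=> n /=; rewrite /component /= => vn.
have : Q n.
  elim: vn Qv => [x y|//|x y z _ IH1 _ IH2 /IH1/IH2//]; exact: QE.
case=> [|[w wB wE]]; first by nia.
have := hM _ (ltn_pmod n p_gt0).
have := leq_div w p; have := ltn_ceil n p_gt0.
nia.
Qed.

Lemma potential_inv_decides (L : nat * nat -> Prop) f c h :
  (forall e, edge e -> L e) -> potential_inv L f c h ->
  0 < f <-> has_infinite_component E.
Proof.
move=> LT; case: f => [[_ cst]|f] //.
by split=> // /(@consistent_finite c h)[] e edge_e; apply: cst => //; exact: LT.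
Qed.

End Potentials.

(** * The edges read off the automaton *)

Lemma conv_addr n j : conv n (n + j) = nseq n l11 ++ nseq j ld1.
Proof.
apply: (@eq_from_nth _ l11) => [|k].
  by rewrite size_mkseq size_cat !size_nseq; lia.
rewrite size_mkseq => k_lt; rewrite nth_mkseq// nth_cat size_nseq !nth_nseq.
have [kn|nk] := ltnP k n; first by rewrite ltn_addr.
by have [-> ->] : (k < n + j) * (k - n < j) by split; lia.
Qed.

(** Counting the symbols 1 in each track recovers both lengths. *)
Lemma conv_inj m n m' n' : conv m n = conv m' n' -> m = m' /\ n = n'.
Proof.
have cnt a b : a <= b -> count (fun k => k < a) (iota 0 b) = a.
  by move=> ab; rewrite -size_filter (congr1 size (@filter_iota_ltn 0 b a ab)) size_iota.
have cnt1 a b : count fst (conv a b) = a.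
  by rewrite count_map (cnt a)// leq_maxl.
have cnt2 a b : count snd (conv a b) = b.
  by rewrite count_map (cnt b)// leq_maxr.
move=> eq_conv; split.
  by rewrite -(cnt1 m n) eq_conv cnt1.
by rewrite -(cnt2 m n) eq_conv cnt2.
Qed.

Section Automaton.

Variables (N : nat) (A : dfa N).

Lemma runs_cat q u w :
  runs A q (u ++ w) = obind (fun r => runs A r w) (runs A q u).
Proof.
rewrite {1}/runs foldl_cat -/(runs A q u); case: (runs A q u) => //=.
by elim: w.
Qed.

Lemma runs_nseqS q k a :
  runs A q (nseq k.+1 a) = obind (fun r => delta A r a) (runs A q (nseq k a)).
Proof. by rewrite -addn1 nseqD runs_cat. Qed.

Lemma runs_nseq_some q k k' a :
  k <= k' -> runs A q (nseq k' a) <> None -> runs A q (nseq k a) <> None.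
Proof.
by move=> kk'; rewrite -(subnKC kk') nseqD runs_cat; case: (runs _ _ _).
Qed.

Lemma nth_encode (q : 'I_N) i : i < 5 ->
  nth 0 (encode A) (5 * q + 2 + i) = nth 0 (encode_state A q) i.
Proof.
move=> i5; rewrite addnAC addn2 /=.
rewrite -{2}(nth_ord_enum q q); have : q < size (enum 'I_N) by rewrite size_enum_ord.
elim: (enum 'I_N) (q : nat) => [//|r s IH] [_|k ks].
  by move: i5; case: i {IH} => [|[|[|[|[|]]]]].
by rewrite mulnS -addnA; exact: IH k ks.
Qed.

Variables (p : nat) (E : nat -> nat -> Prop).
Hypothesis A_standard : standard_one_loop A p.
Hypothesis A_E : recognizes A E.

Lemma loop_gt0 : 0 < p.
Proof. by case: A_standard => -[[]]. Qed.

Lemma state11_add k r : p <= k -> state11 A (k + r * p) = state11 A k.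
Proof.
have [[[_ _ _ loopE] _] _] := A_standard.
move=> pk; elim: r => [|r <-]; first by rewrite addn0.
have -> : k + r.+1 * p = (p + p) + (k - p + r * p) by lia.
have -> : k + r * p = p + (k - p + r * p) by lia.
rewrite /state11 (nseqD (p + p)) (nseqD p (k - p + _)) !runs_cat.
by rewrite -!/(state11 A _) loopE.
Qed.

Lemma state11_some k : exists s, state11 A k = Some s.
Proof.
have [[[p0 _ _ _] _] _] := A_standard.
suff : state11 A k <> None by case: (state11 A k) => // s _; exists s.
have [[[_ some _ _] _] _] := A_standard.
have [kp|pk] := ltnP k p; first by apply: some; lia.
have -> : k = p + (k - p) %% p + (k - p) %/ p * p.
  by have := divn_eq (k - p) p; lia.
rewrite state11_add ?leq_addr//; apply: some.
by rewrite ltn_add2l ltn_pmod.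
Qed.

(** The state after [p + u] letters [l11] lies on the loop, so it represents all vertices from [p]
    on with residue [u]. *)
Definition pattern u j :=
  if obind (fun s => runs A s (nseq j ld1)) (state11 A (p + u)) is Some q
  then final A q else false.

Lemma recognizes_addr n j : E n (n + j) <-> accepts A (nseq n l11 ++ nseq j ld1).
Proof.
rewrite -conv_addr A_E; split=> [Enj|[m [m' [eq_conv]]]]; first by exists n, (n + j).
by have [-> ->] := conv_inj eq_conv.
Qed.

Lemma recognizes_periodic n j :
  p <= n -> j <= p -> E n (n + j) <-> pattern (n %% p) j.
Proof.
move=> pn _; rewrite recognizes_addr /accepts runs_cat -/(state11 A n) /pattern.
suff -> : state11 A n = state11 A (p + n %% p) by [].
have := divn_eq n p; have := loop_gt0 => p0.
have n_ge : 0 < n %/ p by rewrite divn_gt0.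
rewrite -(prednK n_ge) mulSn => nE.
by rewrite {1}nE addnAC state11_add// leq_addr.
Qed.

(** The [ld1]-tail of every (1,1)-state breaks off after [p] letters. *)
Lemma recognizes_short n j : E n (n + j) -> j <= p.
Proof.
rewrite recognizes_addr /accepts runs_cat -/(state11 A n).
have [s sE] := state11_some n; rewrite sE /=.
have [_ /(_ _ _ sE)[_ [_ ends]]] := A_standard.
case: leqP => // /(runs_nseq_some (a := ld1) (q := s)); rewrite ends.
by case: (runs A s (nseq j ld1)) => // q H _; case: H.
Qed.

End Automaton.

(** * A structured language over the random access machine *)

Inductive cmd : Type :=
| Block of seq instr
| Seq of cmd & cmd
| Unless of nat & cmd       (* run the body if X_j = 0 *)
| DoWhile of cmd & nat.     (* repeat the body, at least once, until X_j = 0 *)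

Fixpoint cmd_size c :=
  match c with
  | Block s => size s
  | Seq c1 c2 => cmd_size c1 + cmd_size c2
  | Unless _ c => (cmd_size c).+1
  | DoWhile c _ => (cmd_size c).+1
  end.

(** Jump targets are absolute, so the start address [off] of the code is a parameter. *)
Fixpoint compile off c : seq instr :=
  match c with
  | Block s => s
  | Seq c1 c2 => compile off c1 ++ compile (off + cmd_size c1) c2
  | Unless j c => IJump j (off.+1 + cmd_size c) :: compile off.+1 c
  | DoWhile c j => rcons (compile off c) (IJump j off)
  end.

Lemma size_compile off c : size (compile off c) = cmd_size c.
Proof.
elim: c off => //= [c1 IH1 c2 IH2|j c IH|c IH j] off.
- by rewrite size_cat IH1 IH2.
- by rewrite IH.
- by rewrite size_rcons IH.
Qed.

Definition straight ins := if ins is IJump _ _ then false else true.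

Section Runs.

Variable x : seq nat.

Definition effect (ins : instr) X := Defs.mem (exec x ins (Config 0 X)).

Definition block_effect s X := foldl (fun X ins => effect ins X) X s.

(** Total correctness with a time bound. Quantifying over the surrounding code makes the rules below
    compositional. *)
Definition runsto c X T (Q : (nat -> nat) -> Prop) :=
  forall P1 P2, let P := P1 ++ compile (size P1) c ++ P2 in
  exists t X', [/\ t <= T,
    iter t (step P x) (Config (size P1) X) = Config (size P1 + cmd_size c) X'
  & Q X'].

Lemma step_at P1 ins P2 n X : size P1 = n ->
  step (P1 ++ ins :: P2) x (Config n X) = exec x ins (Config n X).
Proof. by move<-; rewrite /step /= onth_cat ltnn subnn. Qed.

Lemma runsto_imp c X T (Q Q' : _ -> Prop) :
  (forall Y, Q Y -> Q' Y) -> runsto c X T Q -> runsto c X T Q'.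
Proof.
move=> QQ H P1 P2 P; have [t [X' [tT stp QX]]] := H P1 P2.
by exists t, X'; split=> //; exact: QQ.
Qed.

Lemma runsto_block s X (Q : _ -> Prop) :
  all straight s -> Q (block_effect s X) -> runsto (Block s) X (size s) Q.
Proof.
move=> s_straight QX P1 P2 /=; exists (size s), (block_effect s X); split=> //.
elim: s X P1 s_straight {QX} => [|ins s IH] X P1 /= => [_|/andP[ins_s s_s]].
  by rewrite addn0.
rewrite -iterS iterSr step_at//.
have -> : exec x ins (Config (size P1) X) = Config (size P1).+1 (effect ins X).
  by case: ins ins_s.
by have := IH (effect ins X) (rcons P1 ins) s_s; rewrite size_rcons cat_rcons addSnnS.
Qed.

Lemma runsto_seq c1 c2 X T1 T2 Q :
  runsto c1 X T1 (fun Y => runsto c2 Y T2 Q) ->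
  runsto (Seq c1 c2) X (T1 + T2) Q.
Proof.
move=> H P1 P2 P; have [t [Y [tT stp H2]]] := H P1 (compile (size P1 + cmd_size c1) c2 ++ P2).
have [t' [Z [tT' stp' QZ]]] := H2 (P1 ++ compile (size P1) c1) P2.
exists (t' + t), Z; split=> //; first by rewrite addnC leq_add.
rewrite iterD /P /= -!catA stp.
by move: stp'; rewrite size_cat size_compile -!catA addnA.
Qed.

Lemma runsto_unless j c X T (Q : _ -> Prop) :
  (0 < X j -> Q X) -> (X j = 0 -> runsto c X T Q) ->
  runsto (Unless j c) X T.+1 Q.
Proof.
move=> Qpos Qzero P1 P2 P.
have [Xj|Xj] := posnP (X j); last first.
  exists 1, X; split=> //; last exact: Qpos.
  by rewrite /= /P /= step_at//= Xj addSnnS.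
have [t [Y [tT stp QY]]] := Qzero Xj (rcons P1 (IJump j ((size P1).+1 + cmd_size c))) P2.
exists t.+1, Y; split=> //.
rewrite iterSr /P /= step_at//= Xj /=.
by move: stp; rewrite size_rcons cat_rcons addSnnS.
Qed.

(** The invariant is indexed by the number of passes left, and the guard is positive exactly while
    some remain; each pass costs the body and one jump. *)
Lemma runsto_dowhile c j T (I : nat -> (nat -> nat) -> Prop) n X :
  (forall m Y, I m.+1 Y ->
     runsto c Y T (fun Z => I m Z /\ (0 < Z j) = (0 < m))) ->
  I n.+1 X -> runsto (DoWhile c j) X (n.+1 * T.+1) (I 0).
Proof.
move=> body IX P1 P2 P; rewrite /P /= -cats1 -catA /=.
elim: n X IX => [|n IHn] X IX;
    have [t [Y [tT stp [IY Yj]]]] := body _ _ IX P1 (IJump j (size P1) :: P2).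
  exists t.+1, Y; split=> //; first by rewrite mul1n.
  by rewrite iterS stp catA step_at ?size_cat ?size_compile//= Yj addnS.
have [t' [Z [tT' stp' IZ]]] := IHn Y IY.
exists (t' + t.+1), Z; split=> //; first by rewrite mulSn addnC leq_add.
rewrite iterD iterS stp -stp'; congr iter.
by rewrite catA step_at ?size_cat ?size_compile//= Yj.
Qed.

(** * Symbolic execution on registers and array cells *)

Definition nregs := 22.

(* Cells below [nregs] serve as registers and are described by the list [R];
   the remaining cells are described by [M]. *)
Definition memory (R : seq nat) (M : nat -> nat) r :=
  if r < nregs then nth 0 R r else M r.

Definition instr_wf ins :=
  match ins with
  | IConst i _ => i < nregs
  | IAdd i j k | ISub i j k => [&& i < nregs, j < nregs & k < nregs]
  | ILoad i j | IStore i j | IRead i j => (i < nregs) && (j < nregs)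
  | IJump _ _ => false
  end.

Fixpoint cmd_wf c :=
  match c with
  | Block s => all instr_wf s
  | Seq c1 c2 => cmd_wf c1 && cmd_wf c2
  | Unless j c => (j < nregs) && cmd_wf c
  | DoWhile _ _ => false
  end.

(* Kept folded when [nth 0 R] is computed. *)
Definition input := nth 0.

(** Indirect accesses must address cells from [nregs] on, so they never alias a register. *)
Definition instr_wp ins R M (Q : seq nat -> (nat -> nat) -> Prop) : Prop :=
  match ins with
  | IConst i v => Q (set_nth 0 R i v) M
  | IAdd i j k => Q (set_nth 0 R i (nth 0 R j + nth 0 R k)) M
  | ISub i j k => Q (set_nth 0 R i (nth 0 R j - nth 0 R k)) M
  | ILoad i j => nregs <= nth 0 R j /\ Q (set_nth 0 R i (M (nth 0 R j))) M
  | IStore i j => nregs <= nth 0 R i /\ Q R (upd M (nth 0 R i) (nth 0 R j))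
  | IRead i j => Q (set_nth 0 R i (input x (nth 0 R j))) M
  | IJump _ _ => False
  end.

Fixpoint block_wp s R M Q : Prop :=
  if s is ins :: s' then instr_wp ins R M (fun R' M' => block_wp s' R' M' Q)
  else Q R M.

(** Loops get [False]: they need an invariant and are left to [arun_dowhile]. *)
Fixpoint wp c R M (Q : seq nat -> (nat -> nat) -> Prop) : Prop :=
  match c with
  | Block s => block_wp s R M Q
  | Seq c1 c2 => wp c1 R M (fun R' M' => wp c2 R' M' Q)
  | Unless j c =>
    (0 < nth 0 R j -> Q R M) /\ (nth 0 R j = 0 -> wp c R M Q)
  | DoWhile _ _ => False
  end.

Definition arun c R M T (Q : seq nat -> (nat -> nat) -> Prop) :=
  runsto c (memory R M) T (fun X => exists R' M', X = memory R' M' /\ Q R' M').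

Lemma upd_reg R M i v : i < nregs ->
  upd (memory R M) i v = memory (set_nth 0 R i v) M.
Proof.
move=> i_lt; apply/funext => r; rewrite /upd /memory nth_set_nth /=.
by case: eqP => [->|//]; rewrite i_lt.
Qed.

Lemma upd_mem R M i v : nregs <= i ->
  upd (memory R M) i v = memory R (upd M i v).
Proof.
move=> i_ge; apply/funext => r; rewrite /upd /memory.
by case: eqP => [->|//]; rewrite ltnNge i_ge.
Qed.

Lemma memory_reg R M r : r < nregs -> memory R M r = nth 0 R r.
Proof. by rewrite /memory => ->. Qed.

Lemma memory_mem R M r : nregs <= r -> memory R M r = M r.
Proof. by rewrite /memory ltnNge => ->. Qed.

Lemma instr_wf_straight ins : instr_wf ins -> straight ins.
Proof. by case: ins. Qed.

Lemma instr_wpP ins R M Q : instr_wf ins -> instr_wp ins R M Q ->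
  exists R' M', effect ins (memory R M) = memory R' M' /\ Q R' M'.
Proof.
case: ins => //= [i v|i j k|i j k|i j|i j|i j]; rewrite /effect /=.
- by move=> i_lt QR; do 2!eexists; split; [exact: upd_reg|].
- by case/and3P=> i_lt j_lt k_lt QR; do 2!eexists; rewrite !memory_reg// upd_reg//.
- by case/and3P=> i_lt j_lt k_lt QR; do 2!eexists; rewrite !memory_reg// upd_reg//.
- case/andP=> i_lt j_lt [a_ge QR]; do 2!eexists.
  by rewrite (memory_reg _ _ j_lt) memory_mem// upd_reg//.
- case/andP=> i_lt j_lt [a_ge QR]; do 2!eexists.
  by rewrite !memory_reg// upd_mem//.
- by case/andP=> i_lt j_lt QR; do 2!eexists; rewrite !memory_reg// upd_reg//.
Qed.

Lemma arun_imp c R M T (Q Q' : _ -> _ -> Prop) :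
  arun c R M T Q -> (forall R' M', Q R' M' -> Q' R' M') -> arun c R M T Q'.
Proof.
move=> H QQ; apply: runsto_imp H => Y [R' [M' [-> QR]]].
by exists R', M'; split=> //; exact: QQ.
Qed.

Lemma arun_seq c1 c2 R M T1 T2 Q :
  arun c1 R M T1 (fun R' M' => arun c2 R' M' T2 Q) ->
  arun (Seq c1 c2) R M (T1 + T2) Q.
Proof.
by move=> H; apply: runsto_seq; apply: runsto_imp H => Y [R' [M' [-> QR]]].
Qed.

Lemma arun_unless c j R M T Q :
  j < nregs -> (0 < nth 0 R j -> Q R M) -> (nth 0 R j = 0 -> arun c R M T Q) ->
  arun (Unless j c) R M T.+1 Q.
Proof.
move=> j_lt Qpos Qzero; apply: runsto_unless; rewrite memory_reg//.
by move=> /Qpos QR; exists R, M.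
Qed.

Lemma arun_dowhile c j T (I : nat -> seq nat -> (nat -> nat) -> Prop) n R M :
  j < nregs -> 0 < n ->
  (forall m R' M', I m.+1 R' M' ->
     arun c R' M' T (fun R'' M'' => I m R'' M'' /\ (0 < nth 0 R'' j) = (0 < m))) ->
  I n R M -> arun (DoWhile c j) R M (n * T.+1) (I 0).
Proof.
case: n => // n j_lt _ body IR.
pose J m X := exists R' M', X = memory R' M' /\ I m R' M'.
apply: (@runsto_dowhile c j T J); last by exists R, M.
move=> m Y [R' [M' [-> IR']]]; apply: runsto_imp (body _ _ _ IR') => Z.
case=> R'' [M'' [-> [IR'' j_pos]]]; split; first by exists R'', M''.
by rewrite memory_reg.
Qed.

Lemma arun_wp c R M Q : cmd_wf c -> wp c R M Q -> arun c R M (cmd_size c) Q.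
Proof.
elim: c R M Q => [s|c1 IH1 c2 IH2|j c IH|//] R M Q /=.
- move=> s_wf QR; apply: runsto_block.
    by apply: sub_all s_wf; exact: instr_wf_straight.
  elim: s R M s_wf QR => [|ins s IH] R M /=; first by exists R, M.
  by case/andP=> ins_wf s_wf /(instr_wpP ins_wf)[R' [M' [-> /(IH _ _ s_wf)]]].
- case/andP=> wf1 wf2 /(IH1 _ _ _ wf1) H; apply: arun_seq.
  by apply: arun_imp H _ => R' M'; exact: IH2.
- case/andP=> j_lt wf_c [Qpos Qzero]; apply: arun_unless => // /Qzero; exact: IH.
Qed.

End Runs.

(** * Processing one edge *)

(* Cells holding the potential and the class of the residue [w]. *)
Definition ha w := nregs + w.*2.
Definition ca w := nregs.+1 + w.*2.

Lemma ha_inj : injective ha.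
Proof. by move=> i j; rewrite /ha; lia. Qed.

(** Potential and class cells alternate: adding 1 to a pointer leads from the potential to the
    class, adding 2 to the next residue. *)
Lemma addrE : (forall i j, (ha i == ha j) = (i == j)) *
  (forall i j, (ca i == ca j) = (i == j)) *
  (forall i j, (ha i == ca j) = false) *
  (forall i j, (ca i == ha j) = false) *
  (forall i, ha i + 1 = ca i) * (forall i, ha i + 2 = ha i.+1) *
  (forall i j, ha i - ha j = (i - j).*2) * (forall i, nregs <= ha i) *
  (forall i, nregs <= ca i).
Proof. by rewrite /ha /ca /nregs; do ![split]=> *; lia. Qed.

(* The programs refer to registers by their position in this list.  [pe], [pu],
   [pv], [pw] are pointers to potential cells, [pe] being the end of the array;
   [qo] and [q] hold a state plus one, or 0 for a missing transition. *)
Definition regs0 p pe f qo pu q pv s q5 up dn cu cv pw a b t :=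
  [:: 0; 1; 2; 3; nregs; p; pe; f; qo; pu; q; pv; s; q5; up; dn; cu; cv; pw; a; b; t].

Definition regs p := regs0 p (ha p).

(* In [regs] order: 20 receives the class of [pw], and 21 is 0 iff it agrees with
   [cu] (then with [cv]). *)
Definition merge_body : cmd :=
  Seq (Block [:: IAdd 19 18 1; ILoad 20 19;
                 ISub 21 20 16; ISub 19 16 20; IAdd 21 21 19])
  (Seq (Unless 21 (Block [:: ILoad 19 18; IAdd 19 19 15; IStore 18 19]))
  (Seq (Block [:: ISub 21 20 17; ISub 19 17 20; IAdd 21 21 19])
  (Seq (Unless 21 (Block [:: ILoad 19 18; IAdd 19 19 14; IStore 18 19;
                             IAdd 19 18 1; IStore 19 16]))
  (Block [:: IAdd 18 18 2; ISub 21 6 18])))).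

Definition merge_loop := DoWhile merge_body 21.

(** The sweep also runs when the classes agree: then either both gaps are 0 and nothing changes, or
    the flag has become positive. *)
Definition merge_edge :=
  Seq (Block [:: ILoad 19 9; IAdd 19 19 12; ILoad 20 11; ISub 14 19 20; ISub 15 20 19;
                 IAdd 16 9 1; ILoad 16 16; IAdd 17 11 1; ILoad 17 17;
                 ISub 19 16 17; ISub 20 17 16; IAdd 21 19 20])
  (Seq (Unless 21 (Block [:: IAdd 7 7 14; IAdd 7 7 15]))
  (Seq (Block [:: IAdd 18 4 0]) merge_loop)).

(** [merge_h] and [merge_c] on memory, with gaps and classes saved beforehand because the sweep
    overwrites the cells. *)
Definition shifted up dn cu cv (M : nat -> nat) w :=
  M (ha w) + (M (ca w) == cu) * dn + (M (ca w) == cv) * up.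
Definition relabelled cu cv (M : nat -> nat) w : nat :=
  if M (ca w) == cv then cu else M (ca w).

(** The machine tests equality by adding the two truncated differences. *)
Lemma dist_gt0 m n : (0 < m - n + (n - m)) = (m != n).
Proof. by case: eqP; lia. Qed.

Lemma dist_eq0 m n : m - n + (n - m) = 0 -> m = n.
Proof. lia. Qed.

(* Call by value: simplification by name is exponential in the block length. *)
Ltac compute_wp :=
  apply: arun_wp; [by []|];
  cbv beta iota zeta delta [wp block_wp instr_wp nth set_nth regs regs0].

Section MergeLoop.

Variable x : seq nat.

Lemma merge_body_ok p f qo pu q pv s q5 up dn cu cv w a b t M :
  arun x merge_body (regs p f qo pu q pv s q5 up dn cu cv (ha w) a b t) M
    (cmd_size merge_body) (fun R' M' =>
    (exists a' b', R' = regs p f qo pu q pv s q5 up dn cu cv (ha w.+1) a' b' (p - w.+1).*2) /\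
    (forall i, M' (ha i) = if i == w then shifted up dn cu cv M w else M (ha i)) /\
    (forall i, M' (ca i) = if i == w then relabelled cu cv M w else M (ca i))).
Proof.
rewrite /merge_body; compute_wp.
rewrite !addrE !dist_gt0; split=> //.
rewrite /shifted /relabelled.
split=> [/negPf-> | /dist_eq0 cwE]; [|rewrite cwE eqxx; do 2![split=> //]];
  (split=> [/negPf->|/dist_eq0->]; last (rewrite ?eqxx; do 3![split=> //]));
  (split; first by do 2!eexists); split=> i;
  rewrite /upd ?addrE ?eqxx /= ?mul0n ?mul1n ?addn0;
  by case: (eqVneq i w) => [iw|]; rewrite ?iw //; congruence.
Qed.

Lemma merge_loop_ok p f qo pu q pv s q5 up dn cu cv a b t M : 0 < p ->
  arun x merge_loop (regs p f qo pu q pv s q5 up dn cu cv (ha 0) a b t) M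
    (p * (cmd_size merge_body).+1) (fun R' M' =>
    (exists pw' a' b' t', R' = regs p f qo pu q pv s q5 up dn cu cv pw' a' b' t') /\
    forall i, i < p ->
      M' (ha i) = shifted up dn cu cv M i /\ M' (ca i) = relabelled cu cv M i).
Proof.
move=> p_gt0.
(* With [k] passes left, the residues below [p - k] are rewritten and the others still hold the
   values of [M]. *)
pose I k R' M' := k <= p /\
  (exists a' b' t', R' = regs p f qo pu q pv s q5 up dn cu cv (ha (p - k)) a' b' t') /\
  forall i,
    M' (ha i) = (if i < p - k then shifted up dn cu cv M i else M (ha i)) /\
    M' (ca i) = (if i < p - k then relabelled cu cv M i else M (ca i)).
apply: arun_imp (_ : arun x merge_loop _ _ _ (I 0)) _ => [|R' M']; last first.
  case=> _ [[a' [b' [t' ->]]] M'E]; split; first by do 4!eexists.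
  by move=> i ip; have [-> ->] := M'E i; rewrite subn0 ip.
apply: arun_dowhile => //; last first.
  by rewrite /I subnn; split=> //; split=> //; exists a, b, t.
move=> k R' M' [kp [[a' [b' [t' ->]]] M'E]].
apply: arun_imp (merge_body_ok _ _ _ _ _ _ _ _ _ _ _ _ _ _ _ _ _) _.
move=> R'' M'' [[a'' [b'' ->]] [hE cE]].
have pk : (p - k.+1).+1 = p - k by lia.
rewrite pk subKn ?(ltnW kp)//; split; last by rewrite /= double_gt0.
split; first exact: ltnW.
split=> [|i]; first by do 3!eexists.
have -> : (i < p - k) = (i == p - k.+1) || (i < p - k.+1) by lia.
rewrite hE cE; have [] := M'E i; case: eqVneq => [->|_ -> ->] //=.
by rewrite /shifted /relabelled ltnn => -> ->.
Qed.

Definition edge_time p :=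
  12 + (3 + (1 + p * (cmd_size merge_body).+1)).

Lemma merge_edge_ok p f qo u q v s q5 up dn cu cv pw a b t M :
  0 < p ->
  let up' := M (ha u) + s - M (ha v) in
  let dn' := M (ha v) - (M (ha u) + s) in
  arun x merge_edge (regs p f qo (ha u) q (ha v) s q5 up dn cu cv pw a b t) M
    (edge_time p) (fun R' M' =>
    (exists up dn cu cv pw a b t,
      R' = regs p (f + (M (ca u) == M (ca v)) * (up' + dn')) qo (ha u) q (ha v)
             s q5 up dn cu cv pw a b t) /\
    forall i, i < p ->
      M' (ha i) = shifted up' dn' (M (ca u)) (M (ca v)) M i /\
      M' (ca i) = relabelled (M (ca u)) (M (ca v)) M i).
Proof.
move=> p_gt0 up' dn'.
apply: arun_seq; compute_wp; rewrite !addrE; do 4![split=> //].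
apply: arun_seq.
pose f' := f + (M (ca u) == M (ca v)) * (up' + dn').
apply: arun_imp (_ : arun x _ _ _ _ (fun R' M' => exists a b t,
   R' = regs p f' qo (ha u) q (ha v) s q5 up' dn' (M (ca u)) (M (ca v)) pw a b t /\ M' = M)) _.
  compute_wp; rewrite dist_gt0; split=> [/negPf cuv|/dist_eq0 cuv].
    by do 3!eexists; split=> //; rewrite /f' cuv addn0.
  by do 3!eexists; split=> //; rewrite /f' cuv eqxx mul1n addnA.
move=> R' M' [a' [b' [t' [-> ->]]]].
apply: arun_seq; compute_wp; rewrite addn0.
apply: arun_imp (merge_loop_ok _ _ _ _ _ _ _ _ _ _ _ _ _ _ _ p_gt0) _.
move=> R'' M'' [[pw' [a'' [b'' [t'' ->]]]] M''E]; split=> //.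
by do 8!eexists.
Qed.

End MergeLoop.

(* The row of state [q] starts at [5 * q + 2], which is [5 * q.+1 - 3]. *)
Definition edge_body :=
  Seq (Block [:: IAdd 13 10 10; IAdd 13 13 13; IAdd 13 13 10;
                 ISub 19 13 3; IRead 19 19; ISub 21 1 19])
  (Seq (Unless 21 merge_edge)
  (Seq (Block [:: IRead 10 13; IAdd 11 11 2; ISub 21 6 11])
  (Unless 21 (Block [:: IAdd 11 4 0; IAdd 12 12 1])))).

(** The inner loop follows the [ld1]-tail of the outer state, one offset per pass, until a
    transition is missing; then the outer state advances by [l11]. *)
Definition vertex_body :=
  Seq (Block [:: IAdd 10 8 0; IAdd 11 9 0; IConst 12 0])
  (Seq (DoWhile edge_body 10)
  (Block [:: IAdd 13 8 8; IAdd 13 13 13; IAdd 13 13 8; ISub 13 13 2; IRead 8 13;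
             IAdd 9 9 2; ISub 21 6 9])).

(** The machine has no division, so residue and block number of [u + j] are updated
    incrementally. *)
Lemma succ_divmod n p : 0 < p ->
  (n.+1 %% p = if p == (n %% p).+1 then 0 else (n %% p).+1) /\
  (n.+1 %/ p = if p == (n %% p).+1 then (n %/ p).+1 else n %/ p).
Proof.
move=> p_gt0; have lt_p := ltn_pmod n p_gt0.
have dvdE : p %| n.+1 = (p == (n %% p).+1).
  rewrite {1}(divn_eq n p) -addnS dvdn_addr ?dvdn_mull//.
  apply/idP/eqP => [/dvdn_leq|<-]; [lia|exact: dvdnn].
by rewrite modnS divnS// dvdE; case: eqP.
Qed.

Section EdgeBody.

Variables (x : seq nat) (E : nat -> nat -> Prop) (p : nat) (t : nat -> nat -> bool).
Hypothesis p_gt0 : 0 < p.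
Hypothesis E_sym : undirected E.
Hypothesis E_periodic : forall n j, p <= n -> j <= p -> E n (n + j) <-> t (n %% p) j.

(** The lexicographic order in which the two nested loops visit the pairs. *)
Definition before u j (e : nat * nat) := e.1 < u \/ e.1 = u /\ e.2 < j.

Definition edges_done u j f (M : nat -> nat) :=
  potential_inv E p t (before u j) f (fun w => M (ca w)) (fun w => M (ha w)).

Definition body_time := 6 + ((edge_time p).+1 + (3 + 3)).

Lemma edge_body_ok f qo u j q q5 up dn cu cv pw a b d M :
  u < p -> j <= p -> input x (q + q + (q + q) + q - 3) = t u j -> edges_done u j f M ->
  arun x edge_body
    (regs p f qo (ha u) q (ha ((u + j) %% p)) ((u + j) %/ p) q5 up dn cu cv pw a b d) M
    body_time (fun R' M' =>
    exists f' q5 up dn cu cv pw a b d, edges_done u j.+1 f' M' /\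
      R' = regs p f' qo (ha u) (input x (q + q + (q + q) + q))
        (ha ((u + j.+1) %% p)) ((u + j.+1) %/ p) q5 up dn cu cv pw a b d).
Proof.
move=> u_lt jp read_t invM.
apply: arun_seq; compute_wp; rewrite read_t.
apply: arun_seq.
set v := (u + j) %% p; set s := (u + j) %/ p.
apply: arun_imp (_ : arun x _ _ _ _ (fun R' M' =>
   exists f' up dn cu cv pw a b d, edges_done u j.+1 f' M' /\
   R' = regs p f' qo (ha u) q (ha v) s (q + q + (q + q) + q) up dn cu cv pw a b d)) _.
  apply: arun_unless => // [ntuj|/eqP tuj].
    do 9!eexists; split; last by [].
    (* The pair [(u, j)] is no edge, so no new consistency condition arises. *)
    apply: potential_inv_ext invM => // e /and3P[_ _ te] [|[e1 e2]]; first by left.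
    have [e2j|e2j] := eqVneq e.2 j; last by right; split=> //; lia.
    by move: te ntuj; rewrite e1 e2j /= => ->.
  have edge_uj : edge p t (u, j).
    by apply/and3P; split=> //=; move: tuj => /=; case: (t u j).
  apply: arun_imp (merge_edge_ok _ _ _ _ _ _ _ _ _ _ _ _ _ _ _ _ _ p_gt0) _.
  move=> R' M' [[up' [dn' [cu' [cv' [pw' [a' [b' [t' ->]]]]]]]] M'E].
  do 9!eexists; split; last by [].
  have := merge_inv p_gt0 E_sym E_periodic edge_uj invM.
  apply: potential_inv_ext => //.
  - by move=> w /M'E[].
  - by move=> w /M'E[].
  - move=> [e1 e2] _; rewrite /before /= => -[|[->]]; first by right; left.
    by rewrite ltnS leq_eqVlt => /orP[/eqP->|]; [left|right; right].
move=> R' M' [f' [up' [dn' [cu' [cv' [pw' [a' [b' [t' [d1 ->]]]]]]]]]].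
apply: arun_seq; compute_wp; rewrite (addnS u).
have [-> ->] := succ_divmod (u + j) p_gt0.
(* Since [v < p], the truncated pointer difference vanishes exactly when [v.+1 = p]. *)
have vp : v < p by rewrite ltn_pmod.
rewrite -/v -/s !addrE; compute_wp.
split=> [|/eqP] pv.
  have /negPf-> : p != v.+1 by lia.
  by do 10!eexists; split; first exact: d1.
have -> : p == v.+1 by lia.
do 10!eexists; split; first exact: d1.
by rewrite addn0 addn1.
Qed.

End EdgeBody.

(** * The whole program *)

Definition tail_body :=
  Block [:: IAdd 13 10 10; IAdd 13 13 13; IAdd 13 13 10; IRead 10 13; IAdd 5 5 1].

(** The initial class label of a residue is the address of its own potential cell, which keeps
    labels distinct. *)
Definition walk_body :=
  Block [:: IAdd 13 8 8; IAdd 13 13 13; IAdd 13 13 8; ISub 13 13 2; IRead 8 13;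
            IAdd 19 9 1; IStore 19 9; IAdd 9 9 2; ISub 21 21 1].

(* The tail loop measures [p] as the length of the tail of the initial state,
   the walk loop moves to the entry of the (1,1)-loop and makes all classes
   singletons, and the last loop processes the edges. *)
Definition main_cmd :=
  Seq (Block [:: IConst 1 1; IConst 2 2; IConst 3 3; IConst 4 nregs;
                 IRead 10 1; IAdd 10 10 1; IAdd 8 10 0])
  (Seq (DoWhile tail_body 10)
  (Seq (Block [:: ISub 5 5 1; IAdd 9 4 0; IAdd 21 5 0])
  (Seq (DoWhile walk_body 21)
  (Seq (Block [:: IAdd 6 9 0; IAdd 9 4 0])
  (Seq (DoWhile vertex_body 21)
  (Block [:: ISub 19 1 7; ISub 0 1 19])))))).

(** * Correctness of the loops and of the whole program *)

Section Main.

Variables (N : nat) (A : dfa N) (p : nat) (E : nat -> nat -> Prop).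
Hypothesis A_standard : standard_one_loop A p.
Hypothesis A_E : recognizes A E.
Hypothesis E_sym : undirected E.

Let p_gt0 : 0 < p := loop_gt0 A_standard.
Let E_short := recognizes_short A_standard A_E.
Let E_periodic := recognizes_periodic A_standard A_E.
Let x := encode A.

Lemma read_final (s : 'I_N) :
  input x (s.+1 + s.+1 + (s.+1 + s.+1) + s.+1 - 3) = final A s.
Proof.
have -> : s.+1 + s.+1 + (s.+1 + s.+1) + s.+1 - 3 = 5 * s + 2 + 0 by lia.
by rewrite /input nth_encode.
Qed.

Lemma read_l11 (s : 'I_N) :
  input x (s.+1 + s.+1 + (s.+1 + s.+1) + s.+1 - 2) = encode_target (delta A s l11).
Proof.
have -> : s.+1 + s.+1 + (s.+1 + s.+1) + s.+1 - 2 = 5 * s + 2 + 1 by lia.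
by rewrite /input nth_encode.
Qed.

Lemma read_ld1 (s : 'I_N) :
  input x (s.+1 + s.+1 + (s.+1 + s.+1) + s.+1) = encode_target (delta A s ld1).
Proof.
have -> : s.+1 + s.+1 + (s.+1 + s.+1) + s.+1 = 5 * s + 2 + 3 by lia.
by rewrite /input nth_encode.
Qed.

Lemma read_state11 (s : 'I_N) k : state11 A k = Some s ->
  input x (s.+1 + s.+1 + (s.+1 + s.+1) + s.+1 - 2) = encode_target (state11 A k.+1).
Proof. by rewrite read_l11 /state11 runs_nseqS => ->. Qed.

Lemma read_tail (s r : 'I_N) j : runs A s (nseq j ld1) = Some r ->
  input x (r.+1 + r.+1 + (r.+1 + r.+1) + r.+1) = encode_target (runs A s (nseq j.+1 ld1)).
Proof. by rewrite read_ld1 runs_nseqS => ->. Qed.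

Lemma tail_some k s j : state11 A k = Some s -> j <= p ->
  exists r, runs A s (nseq j ld1) = Some r.
Proof.
move=> sE jp; have [_ /(_ _ _ sE)[_ [some _]]] := A_standard.
by have := runs_nseq_some jp some; case: (runs _ _ _) => // r; exists r.
Qed.

Lemma tail_end k s : state11 A k = Some s -> runs A s (nseq p.+1 ld1) = None.
Proof. by move=> sE; have [_ /(_ _ _ sE)[_ []]] := A_standard. Qed.

Lemma vertex_loop_ok f u s q5 up dn cu cv pw a b d M :
  u < p -> state11 A (p + u) = Some s -> edges_done E p (pattern A p) u 0 f M ->
  arun x (DoWhile edge_body 10)
    (regs p f s.+1 (ha u) s.+1 (ha u) 0 q5 up dn cu cv pw a b d) M
    (p.+1 * (body_time p).+1) (fun R' M' =>
    exists f' q pv s' q5 up dn cu cv pw a b d, edges_done E p (pattern A p) u.+1 0 f' M' /\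
      R' = regs p f' s.+1 (ha u) q pv s' q5 up dn cu cv pw a b d).
Proof.
move=> u_lt sE invM.
(* The [p.+1] passes cover the offsets from 0 to [p], hence all edges listed at [u]. *)
pose I k R' M' := k <= p.+1 /\ let j := p.+1 - k in
  exists f' q5 up dn cu cv pw a b d, edges_done E p (pattern A p) u j f' M' /\
  R' = regs p f' s.+1 (ha u) (encode_target (runs A s (nseq j ld1)))
       (ha ((u + j) %% p)) ((u + j) %/ p) q5 up dn cu cv pw a b d.
apply: arun_imp (_ : arun x _ _ _ _ (I 0)) _ => [|R' M']; last first.
  case=> _ [f' [q5' [up' [dn' [cu' [cv' [pw' [a' [b' [d' [d1 ->]]]]]]]]]]].
  do 13!eexists; split; last by [].
  apply: potential_inv_ext d1 => // e /and3P[_ e2 _]; rewrite /before subn0 => -[|[]//].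
  by rewrite !ltnS leq_eqVlt => /orP[/eqP->|]; [right|left].
apply: arun_dowhile => //; last first.
  rewrite /I subnn addn0 modn_small// divn_small//; split=> //.
  by do 10!eexists; split; first exact: invM.
move=> k R' M' [kp].
rewrite subSS; set j := p - k => -[f' [q5' [up' [dn' [cu' [cv' [pw' [a' [b' [d' [d1 ->]]]]]]]]]]].
have jp : j <= p by rewrite leq_subr.
have [r rE] := tail_some sE jp.
have jS : p.+1 - k = j.+1 by rewrite subSn.
rewrite rE /encode_target.
apply: arun_imp (edge_body_ok p_gt0 E_sym E_periodic _ _ _ _ _ _ _ _ _ _ u_lt jp _ d1) _.
  by rewrite read_final /pattern sE /= rE.
move=> R'' M'' [f'' [q5'' [up'' [dn'' [cu'' [cv'' [pw'' [a'' [b'' [d'' [d2 ->]]]]]]]]]]].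
rewrite (read_tail rE); split.
  split; first exact: ltnW.
  by rewrite jS; do 10!eexists; split; first exact: d2.
(* The guard is the encoded next state, which is 0 exactly when the tail is exhausted. *)
rewrite /=; have [k0|k_gt0] := posnP k.
  by rewrite /j k0 subn0 (tail_end sE).
have [|r' ->] := @tail_some _ _ j.+1 sE; first by lia.
by [].
Qed.

Definition vertex_time := 3 + (p.+1 * (body_time p).+1 + 7).

Lemma main_loop_ok f s q pv s' q5 up dn cu cv pw a b d M :
  state11 A p = Some s -> edges_done E p (pattern A p) 0 0 f M ->
  arun x (DoWhile vertex_body 21)
    (regs p f s.+1 (ha 0) q pv s' q5 up dn cu cv pw a b d) M
    (p * vertex_time.+1) (fun R' M' =>
    exists f' qo pu q pv s' q5 up dn cu cv pw a b d, edges_done E p (pattern A p) p 0 f' M' /\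
      R' = regs p f' qo pu q pv s' q5 up dn cu cv pw a b d).
Proof.
move=> sE invM.
pose I k R' M' := k <= p /\ let u := p - k in
  exists f' q pv s' q5 up dn cu cv pw a b d, edges_done E p (pattern A p) u 0 f' M' /\
  R' = regs p f' (encode_target (state11 A (p + u))) (ha u) q pv s' q5 up dn cu cv pw a b d.
apply: arun_imp (_ : arun x _ _ _ _ (I 0)) _ => [|R' M']; last first.
  case=> _ [f' [q' [pv' [s'' [q5' [up' [dn' [cu' [cv' [pw' [a' [b' [d' [d1 ->]]]]]]]]]]]]]].
  by do 15!eexists; rewrite subn0 in d1; split; first exact: d1.
apply: arun_dowhile => //; last first.
  rewrite /I subnn addn0 sE; split=> //.
  by do 13!eexists; split; first exact: invM.
move=> k R' M' [kp] /=; set u := p - k.+1.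
case=> [f' [q' [pv' [s'' [q5' [up' [dn' [cu' [cv' [pw' [a' [b' [d' [d1 ->]]]]]]]]]]]]]].
have [r rE] := state11_some A_standard (p + u); rewrite rE.
have u_lt : u < p by rewrite /u; lia.
have uS : p - k = u.+1 by rewrite /u; lia.
apply: arun_seq; compute_wp; rewrite !addn0.
apply: arun_seq; apply: arun_imp (vertex_loop_ok _ _ _ _ _ _ _ _ _ u_lt rE d1) _.
move=> R'' M'' [f'' [q'' [pv'' [s3 [q5'' [up'' [dn'' [cu'' [cv'' [pw'' [a'' [b'' [d'' [d2 ->]]]]]]]]]]]]]].
compute_wp; rewrite !addrE (read_state11 rE); split.
  split; first exact: ltnW.
  rewrite uS -addnS.
  by do 13!eexists; split; first exact: d2.
by rewrite double_gt0 subn_gt0 -uS; lia.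
Qed.

(** The missing transition is noticed only in an extra pass, so the counter ends at [p.+1] and 1 is
    subtracted afterwards. *)
Lemma tail_loop_ok k s qo M : state11 A k = Some s ->
  arun x (DoWhile tail_body 10)
    (regs0 0 0 0 qo 0 s.+1 0 0 0 0 0 0 0 0 0 0 0) M (p.+1 * 6) (fun R' M' =>
    M' = M /\ exists q5, R' = regs0 p.+1 0 0 qo 0 0 0 0 q5 0 0 0 0 0 0 0 0).
Proof.
move=> sE.
pose I k R' M' := k <= p.+1 /\ let j := p.+1 - k in M' = M /\ exists q5,
  R' = regs0 j 0 0 qo 0 (encode_target (runs A s (nseq j ld1))) 0 0 q5 0 0 0 0 0 0 0 0.
apply: arun_imp (_ : arun x _ _ _ _ (I 0)) _ => [|R' M']; last first.
  by case=> _ [-> [q5 ->]]; split=> //; exists q5; rewrite subn0 (tail_end sE).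
apply: arun_dowhile => //; last first.
  by rewrite /I subnn; split=> //; split=> //; exists 0.
move=> m R' M' [mp]; rewrite subSS => -[-> [q5 ->]].
have [r rE] := tail_some sE (leq_subr m p); rewrite rE /tail_body.
compute_wp; rewrite (read_tail rE) addn1 -subSn//; split.
  by split; [exact: ltnW|split=> //; eexists].
have [->|m_gt0] := posnP m; first by rewrite subn0 (tail_end sE).
by have [|r' ->] := @tail_some _ _ (p.+1 - m) sE; first by lia.
Qed.

Lemma walk_loop_ok q5 M : (forall i, M (ha i) = 0) ->
  arun x (DoWhile walk_body 21)
    (regs0 p 0 0 (init A).+1 (ha 0) 0 0 0 q5 0 0 0 0 0 0 0 p) M (p * 10)
    (fun R' M' => ((forall i, M' (ha i) = 0) /\ forall i, i < p -> M' (ca i) = ha i) /\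
    exists q5 a, R' = regs0 p 0 0 (encode_target (state11 A p)) (ha p) 0 0 0 q5 0 0 0 0 0 a 0 0).
Proof.
move=> M0.
pose I k R' M' := k <= p /\ let j := p - k in
  ((forall i, M' (ha i) = 0) /\ forall i, i < j -> M' (ca i) = ha i) /\
  exists q5 a, R' = regs0 p 0 0 (encode_target (state11 A j)) (ha j) 0 0 0 q5 0 0 0 0 0 a 0 k.
apply: arun_imp (_ : arun x _ _ _ _ (I 0)) _ => [|R' M']; last first.
  by case=> _; rewrite subn0.
apply: arun_dowhile => //; last first.
  by rewrite /I subnn; split=> //; split=> //; exists q5, 0.
move=> m R' M' [mp] /=; set j := p - m.+1 => -[[hE cE] [q5' [a ->]]].
have jS : p - m = j.+1 by rewrite /j; lia.
have [r rE] := state11_some A_standard j; rewrite rE /walk_body.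
compute_wp; rewrite !addrE (read_state11 rE) subn1; split=> //; split=> //.
split; first exact: ltnW.
rewrite jS; split; last by do 2!eexists.
split=> i; rewrite /upd !addrE // ltnS leq_eqVlt.
by case: eqVneq => [->//|_ /=]; exact: cE.
Qed.

Definition main_time :=
  7 + (p.+1 * 6 + (3 + (p * 10 + (2 + (p * vertex_time.+1 + 2))))).

Lemma main_ok : arun x main_cmd (nseq nregs 0) (fun=> 0) main_time
  (fun R' M' => exists2 b : bool, nth 0 R' 0 = b & b <-> has_infinite_component E).
Proof.
apply: arun_seq; rewrite /nregs /nseq /ncons /iter; compute_wp.
apply: arun_seq.
have -> : input x 1 + 1 = (init A).+1 by rewrite addn1.
apply: arun_imp (@tail_loop_ok 0 (init A) _ _ erefl) _ => R1 M1 [-> [q5 ->]].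
apply: arun_seq; compute_wp; rewrite subn1 !addn0 /=.
apply: arun_seq; apply: arun_imp (walk_loop_ok _ _) _ => // R2 M2 [[hE cE] [q5' [a ->]]].
apply: arun_seq; compute_wp; rewrite !addn0.
have [s sE] := state11_some A_standard p; rewrite sE.
apply: arun_seq; apply: arun_imp (main_loop_ok _ _ _ _ _ _ _ _ _ _ _ _ sE _) _ => [|R3 M3].
  apply: (@potential_inv_ext E p _ p_gt0 (fun=> False) _ 0 ha (fun=> 0)) => //.
    by move=> e _ [|[]].
  exact/potential_inv0/ha_inj.
case=> [f [qo [pu [q [pv [s' [q5'' [up [dn [cu [cv [pw [a' [b [d [inv ->]]]]]]]]]]]]]]]].
(* The answer is [1 - (1 - f)], which truncation turns into a bit. *)
compute_wp; exists (0 < f); first by lia.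
apply: (potential_inv_decides p_gt0 E_sym E_short E_periodic _ inv).
by case=> u j /and3P[u_lt _ _]; left.
Qed.

End Main.

(** * Time bound and conclusion *)

Lemma main_time_bound p : 0 < p -> main_time p <= 1000 * p ^ 3.
Proof.
rewrite /main_time /vertex_time /body_time /edge_time /= => p_gt0.
(* Three nested loops, over residues, offsets and swept cells, give a cubic polynomial; its lower
   powers are absorbed as [p] is positive. *)
have p2 : p <= p * p by rewrite leq_pmulr.
have p3 : p * p <= p * p * p by rewrite leq_pmulr.
by rewrite !expnS expn0 muln1 mulnA; lia.
Qed.

Theorem theorem5p1 :
  exists (P : seq instr) (C : nat),
    forall (N : nat) (A : dfa N) (p : nat) (E : nat -> nat -> Prop),
      standard_one_loop A p ->
      recognizes A E ->
      undirected E ->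
      finite_degree E ->
      exists b : bool,
        answers_within P (encode A) (C * p ^ 3) b /\
        (b <-> has_infinite_component E).
Proof.
exists (compile 0 main_cmd), 1000 => N A p E A_standard A_E E_sym _.
have [t [X [tT stp [R [M [XE [b Rb bE]]]]]]] := main_ok A_standard A_E E_sym [::] [::].
exists b; split=> //; rewrite /answers_within.
(* A halted machine stays put, so the exact running time may be raised to the bound. *)
have fin T : t <= T -> ram_run (compile 0 main_cmd) (encode A) T = Config (cmd_size main_cmd) X.
  move=> /subnK <-; rewrite /ram_run iterD.
  have -> : (fun=> 0) = memory (nseq nregs 0) (fun=> 0) :> (nat -> nat).
    by apply/funext => r; rewrite /memory nth_nseq !if_same.
  move: stp; rewrite cat0s cats0 => ->.
  elim: (T - t) => //= k ->.
  by rewrite /step onth_default // size_compile.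
have tT' : t <= 1000 * p ^ 3.
  by apply: leq_trans tT (main_time_bound _); exact: loop_gt0 A_standard.
by rewrite fin // /halted size_compile /= leqnn XE /memory /= Rb.
Qed.
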